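(* Let $K$ be a number field, $n\ge 1$, $V=K^{2n}$ with a non-degenerate alternating bilinear form $\langle\ ,\ \rangle$. Let $v_1,\dots,v_n,v_{\bar n},\dots,v_{\bar 1}\in V\setminus\{0\}$ satisfy the isotropy condition, let $m$ be the matrix with these columns, and let $[m]=[v_1,\dots,v_n;v_{\bar n},\dots,v_{\bar 1}]\in \tilde H_{n-1}(\partial\bar X;\mathbb{Z})$ be the associated symplectic modular symbol. Choose $x\in V\setminus\{0\}$ and let $D_x=\{i\in[\![n]\!]^{\pm} : \langle x,v_i\rangle=0\}$. For $i\in[\![n]\!]^{\pm}\setminus D_x$ let $m_i$ be the matrix obtained from $m$ by replacing the column $v_{\bar\imath}$ by $x$ and, for every $j\in[\![n]\!]^{\pm}\setminus\{i,\bar\imath\}$, replacing the column $v_j$ by $x_{ij}=\langle x,v_i\rangle v_j-\langle x,v_j\rangle v_i$ (the column $v_i$ being left unchanged). Then in $\tilde H_{n-1}(\partial\bar X;\mathbb{Z})$ one has $$[m]=\sum_{i\in[\![n]\!]^{\pm}\setminus D_x}[m_i].$$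
   Context: Indices: for an integer $k$ put $\bar k=2n+1-k$, and let $[\![n]\!]^{\pm}=\{1,\dots,n,\bar n,\dots,\bar 1\}$ (so $\bar{\bar k}=k$). A nonempty subset $I\subset[\![n]\!]^{\pm}$ is isotropic if $i\neq\bar\jmath$ for all $i,j\in I$. A subspace $F\subset V$ is isotropic if the form vanishes identically on it. Vectors $v_1,\dots,v_n,v_{\bar n},\dots,v_{\bar 1}\in V$ satisfy the isotropy condition if for every isotropic subset $I\subset[\![n]\!]^{\pm}$ the span of $\{v_i: i\in I\}$ is an isotropic subspace. Building: $\mathscr{B}$ is the Tits building of $Sp_{2n}(K)$ (the group of $g\in GL_{2n}(K)$ preserving the form): the simplicial complex whose vertices are the nonzero isotropic subspaces of $V$ and whose simplices are the flags of such subspaces. Cross-polytope: $\partial\beta_n$ is the first barycentric subdivision of the boundary complex of the cross-polytope with vertices $\pm e_1,\dots,\pm e_n\in\mathbb{R}^n$; writing $e_{\bar\imath}=-e_i$, its vertices correspond to isotropic subsets $I\subset[\![n]\!]^{\pm}$ (the face spanned by $\{e_i:i\in I\}$) and its simplices to proper flags of isotropic subsets. Its geometric realization is an $(n-1)$-sphere; fix once and for all an orientation, with fundamental class $\xi$ (for $n=1$, the class in reduced $H_0$). Borel-Serre boundary: let $G$ be the $\mathbb{Q}$-group with $G(\mathbb{Q})=Sp_{2n}(K)$ (restriction of scalars), $X$ its symmetric space, $\bar X$ the Borel-Serre partial compactification of $X$, $\partial\bar X$ its boundary. There is a homotopy equivalence $h\colon\mathscr{B}\to\partial\bar X$ compatible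 with the actions of $G(\mathbb{Q})$ and taking a distinguished apartment $A_0$ homeomorphically onto the boundary $\partial Z$ of the closure $Z$ in $\bar X$ of $A e$. Here $e\in X$ is the basepoint, $A=T(\mathbb{R})^0$ and $T$ is a maximal $\mathbb{Q}$-split torus stable under the Cartan involution at $e$; $A_0$ is the apartment of a symplectic basis of eigenvectors of $T$. Symplectic modular symbol: given nonzero vectors satisfying the isotropy condition, let $\phi\colon\partial\beta_n\to\mathscr{B}$ be the simplicial map sending the vertex $I$ to the span of $\{v_i:i\in I\}$. Then $[v_1,\dots,v_n;v_{\bar n},\dots,v_{\bar 1}]:=h_*\phi_*(\xi)\in\tilde H_{n-1}(\partial\bar X;\mathbb{Z})$; it is also written $[m]$, where $m$ is the matrix with columns $v_1,\dots,v_n,v_{\bar n},\dots,v_{\bar 1}$ in this order. By convention $[m]=0$ if some column of $m$ is zero. (Via $h_*$, the assertion is equivalent to the same identity among the classes $\phi_*(\xi)$ in $\tilde H_{n-1}(\mathscr{B};\mathbb{Z})$.) *)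

(* Defs.v *)
From HB Require Import structures.
From mathcomp Require Import freeg.
From mathcomp Require Import all_boot all_order all_algebra all_field.
From mathcomp Require Import generic_quotient ring_quotient sesquilinear boolp.
From mathcomp Require Import zify.

Set Implicit Arguments.
Unset Strict Implicit.
Unset Printing Implicit Defensive.

Import Order.TTheory GRing.Theory Num.Theory.

Local Open Scope ring_scope.
Local Open Scope quotient_scope.

(* Reduced simplicial homology, over the integers, of the order complex of a
   poset P: vertices are the elements of P and simplices are the finite strict
   chains, each one oriented by its increasing enumeration. *)

Section OrderComplex.
Context {d : Order.disp_t} (P : porderType d).

Definition strict_chain k (s : {ffun 'I_k -> P}) : bool :=
  [forall i : 'I_k, forall j : 'I_k, (i < j)%N ==> (s i < s j)%O].

(* k counts vertices: the dimension is k - 1, and k = 0 is the empty simplex. *)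
Record simplex k := Simplex {
  vertices : {ffun 'I_k -> P};
  _ : strict_chain vertices }.

HB.instance Definition _ k := [isSub for @vertices k].
HB.instance Definition _ k := [Choice of simplex k by <:].

Lemma strict_chainP k (s : {ffun 'I_k -> P}) :
  reflect (forall i j : 'I_k, (i < j)%N -> (s i < s j)%O) (strict_chain s).
Proof.
apply: (iffP forallP) => [h i j|h i].
  by move/forallP/(_ j)/implyP: (h i).
by apply/forallP=> j; apply/implyP/h.
Qed.

Definition face_vertices k (s : {ffun 'I_k.+1 -> P}) (i : 'I_k.+1) :=
  [ffun j : 'I_k => s (lift i j)].

Lemma face_subproof k (s : simplex k.+1) (i : 'I_k.+1) :
  strict_chain (face_vertices (vertices s) i).
Proof.
apply/strict_chainP=> a b ab; rewrite !ffunE.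
move/strict_chainP: (valP s); apply.
by rewrite /= /bump; lia.
Qed.

Definition face k (s : simplex k.+1) (i : 'I_k.+1) : simplex k :=
  Simplex (face_subproof s i).

Definition chain k := {freeg (simplex k) / int}.

Definition boundary k (c : chain k.+1) : chain k :=
  fglift (fun s => \sum_(i < k.+1) (-1) ^+ i *: (<< face s i >> : chain k)) c.

Lemma boundary_is_additive k : zmod_morphism (@boundary k).
Proof. exact: lift_is_additive. Qed.

HB.instance Definition _ k :=
  GRing.isZmodMorphism.Build (chain k.+1) (chain k) (@boundary k)
    (@boundary_is_additive k).

(* From here on k is the dimension. In dimension 0 the boundary map goes to
   chain 0, free on the empty simplex: it is the augmentation. *)
Definition is_cycle k : {pred chain k.+1} := [pred c | boundary c == 0].

Lemma is_cycle_closed k : zmod_closed (@is_cycle k).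
Proof.
split=> [|x y]; rewrite !inE ?raddf0 // => /eqP hx /eqP hy.
by rewrite raddfB /= hx hy subrr.
Qed.

HB.instance Definition _ k :=
  GRing.isZmodClosed.Build (chain k.+1) (@is_cycle k) (@is_cycle_closed k).

Record cycle k := Cycle { cycle_chain : chain k.+1; _ : cycle_chain \in @is_cycle k }.

HB.instance Definition _ k := [isSub for @cycle_chain k].
HB.instance Definition _ k := [Choice of cycle k by <:].
HB.instance Definition _ k := [SubChoice_isSubZmodule of cycle k by <:].

Definition is_boundary k : {pred cycle k} :=
  [pred z | `[< exists b : chain k.+2, cycle_chain z = boundary b >]].

Lemma is_boundary_closed k : zmod_closed (@is_boundary k).
Proof.
split=> [|x y]; rewrite !inE; first by apply/asboolP; exists 0; rewrite raddf0.
move=> /asboolP[b hb] /asboolP[c hc]; apply/asboolP; exists (b - c).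
by rewrite !raddfB /= -hb -hc.
Qed.

HB.instance Definition _ k :=
  GRing.isZmodClosed.Build (cycle k) (@is_boundary k) (@is_boundary_closed k).

Definition reduced_homology k := Quotient.quot (@is_boundary k).

HB.instance Definition _ k := GRing.Zmodule.on (reduced_homology k).

Definition homology_class k (z : cycle k) : reduced_homology k :=
  \pi_(Quotient.quot (@is_boundary k)) z.

Lemma homology_class_eq k (z1 z2 : cycle k) :
  homology_class z1 = homology_class z2 <-> z1 - z2 \in @is_boundary k.
Proof. by rewrite /homology_class Quotient.idealrBE; split=> [->|/eqP]. Qed.

End OrderComplex.

Section AdditiveFreeg.
Variables (T : choiceType) (M : zmodType).
Implicit Types g h : {additive {freeg T / int} -> M}.

Lemma fgliftU1 (R : nzRingType) (N : lmodType R) (g : T -> N) x :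
  fglift g << x >> = g x.
Proof. by rewrite liftU scale1r. Qed.

Lemma additive_freeg_eq g h : (forall x, g << x >> = h << x >>) -> g =1 h.
Proof.
move=> gh D; rewrite -[D]freeg_sumE !raddf_sum; apply: eq_bigr => x _.
by rewrite -[coeff x D]intz -freegU_mulz !raddfMz gh.
Qed.

Lemma additive_freeg_eq0 g : (forall x, g << x >> = 0) -> forall D, g D = 0.
Proof.
move=> g0 D; rewrite -[D]freeg_sumE raddf_sum big1 // => x _.
by rewrite -[coeff x D]intz -freegU_mulz raddfMz g0 mul0rz.
Qed.
End AdditiveFreeg.

Section InducedMap.
Context {d d' : Order.disp_t} (P : porderType d) (Q : porderType d').
Variable f : P -> Q.

(* A simplex with degenerate image is sent to 0. *)
Definition push_simplex k (s : simplex P k) : chain Q k :=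
  if insub [ffun i => f (vertices s i)] is Some t then << t >> else 0.

Definition push_chain k (c : chain P k) : chain Q k := fglift (@push_simplex k) c.

Lemma push_chain_is_additive k : zmod_morphism (@push_chain k).
Proof. exact: lift_is_additive. Qed.

HB.instance Definition _ k :=
  GRing.isZmodMorphism.Build (chain P k) (chain Q k) (@push_chain k)
    (@push_chain_is_additive k).

Hypothesis f_homo : {homo f : x y / (x <= y)%O}.

Lemma push_simplexN k (s : simplex P k) (a b : 'I_k) : (a < b)%N ->
  f (vertices s a) = f (vertices s b) -> push_simplex s = 0.
Proof.
move=> ab fab; rewrite /push_simplex; case: insubP => // t /strict_chainP/(_ _ _ ab).
by rewrite !ffunE fab ltxx.
Qed.

Lemma degenerate_adjacent k (s : simplex P k.+1) :
  ~~ strict_chain [ffun i => f (vertices s i)] ->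
  exists i : 'I_k, f (vertices s (widen_ord (leqnSn k) i)) = f (vertices s (lift ord0 i)).
Proof.
move=> ns; apply/not_existsP => hne; case/strict_chainP: ns.
have vmono (i j : 'I_k.+1) : (i < j)%N -> (vertices s i < vertices s j)%O.
  by move/strict_chainP: (valP s); apply.
have step (i j : 'I_k.+1) : j = i.+1 :> nat -> (f (vertices s i) < f (vertices s j))%O.
  move=> ji; have ik : (i < k)%N by rewrite -ltnS -ji.
  rewrite lt_neqAle f_homo ?andbT ?ltW ?vmono ?ji //.
  apply/eqP; have := hne (Ordinal ik).
  have -> : widen_ord (leqnSn k) (Ordinal ik) = i by apply: val_inj.
  by have -> // : lift ord0 (Ordinal ik) = j by apply: val_inj; rewrite /= ji.
move=> i j ij; rewrite !ffunE.
have ik : (i.+1 < k.+1)%N by rewrite (leq_ltn_trans ij).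
apply: lt_le_trans (step i (Ordinal ik) erefl) _; apply: f_homo.
case: (ltngtP i.+1 j) ij => [ij _|//|ij _].
  by apply/ltW/vmono.
by rewrite (_ : Ordinal ik = j) //; apply: val_inj.
Qed.

Lemma push_simplex_eq k (s1 s2 : simplex P k) :
  (forall j, f (vertices s1 j) = f (vertices s2 j)) ->
  push_simplex s1 = push_simplex s2.
Proof.
move=> h; rewrite /push_simplex.
by rewrite (_ : [ffun _ => _] = [ffun i => f (vertices s2 i)]) //; apply/ffunP=> j; rewrite !ffunE.
Qed.

Lemma push_boundary_simplex k (s : simplex P k.+1) :
  \sum_(i < k.+1) (-1) ^+ i *: push_simplex (face s i) = boundary (push_simplex s).
Proof.
have [st|nst] := boolP (strict_chain [ffun i => f (vertices s i)]).
  rewrite {2}/push_simplex insubT /boundary fgliftU1; apply: eq_bigr => i _; congr (_ *: _).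
  rewrite /push_simplex; case: insubP => [t _ tE|].
    by congr << _ >>; apply/val_inj/ffunP => j; rewrite tE !ffunE.
  case/negP; apply/strict_chainP => a b ab; rewrite !ffunE.
  move/strict_chainP: st => /(_ (lift i a) (lift i b)); rewrite !ffunE; apply.
  by rewrite /= /bump; lia.
have [i0 fab] := degenerate_adjacent nst.
set a := widen_ord _ _ in fab; set b := lift _ _ in fab.
have va : a = i0 :> nat by [].
have vb : b = i0.+1 :> nat by [].
have ab : (a < b)%N by rewrite va vb.
have anb : b != a by apply/eqP => /(congr1 (@nat_of_ord _)); rewrite va vb; lia.
rewrite (push_simplexN ab fab) raddf0 (bigD1 a) // (bigD1 b) // big1 => [|i /andP[/= ia ib]].
  rewrite /= addr0 (_ : push_simplex (face s b) = push_simplex (face s a)).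
    by rewrite /bump /= exprS mulN1r scaleNr subrr.
  apply: push_simplex_eq => j; rewrite !ffunE.
  have lb : lift b j = bump i0.+1 j :> nat by [].
  have la : lift a j = bump i0 j :> nat by [].
  move: lb la; rewrite /bump; have [ji|/eqP ji] := eqVneq (j : nat) i0 => lb la.
    have -> : lift b j = a by apply: ord_inj; rewrite lb va ji; lia.
    by have -> : lift a j = b by apply: ord_inj; rewrite la vb ji; lia.
  by congr (f (vertices s _)); apply: ord_inj; rewrite la lb; lia.
have [a' a'E _] := unlift_some ia; have [b' b'E _] := unlift_some ib.
rewrite (@push_simplexN _ _ a' b') ?scaler0 //; last by rewrite !ffunE -a'E -b'E.
by move: ab; rewrite a'E b'E /= /bump; lia.
Qed.

Lemma push_boundary k (c : chain P k.+1) :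
  push_chain (boundary c) = boundary (push_chain c).
Proof.
apply: (@additive_freeg_eq _ _ (@push_chain k \o @boundary _ P k)
  (@boundary _ Q k \o @push_chain k.+1)) => s /=.
rewrite {1}/boundary /(push_chain << s >>) !fgliftU1 raddf_sum -push_boundary_simplex.
by apply: eq_bigr => i _; rewrite raddfZsign /= /push_chain fgliftU1.
Qed.

Lemma push_cycle_subproof k (z : cycle P k) :
  push_chain (cycle_chain z) \in @is_cycle _ Q k.
Proof.
have /eqP hz : boundary (cycle_chain z) == 0 by exact: (valP z).
by rewrite inE -push_boundary hz raddf0.
Qed.

Definition push_cycle k (z : cycle P k) : cycle Q k := Cycle (push_cycle_subproof z).

Definition homology_map k (c : reduced_homology P k) : reduced_homology Q k :=
  homology_class (push_cycle (repr c)).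

Lemma homology_map_class k (z : cycle P k) :
  homology_map (homology_class z) = homology_class (push_cycle z).
Proof.
have : homology_class (repr (homology_class z)) = homology_class z by rewrite /homology_class reprK.
move=> /homology_class_eq; rewrite inE => /asboolP[b /= hb].
apply/homology_class_eq; rewrite inE; apply/asboolP; exists (push_chain b).
by rewrite -push_boundary -hb raddfB.
Qed.
End InducedMap.


Section BoundaryBoundary.
Context {d : Order.disp_t} (P : porderType d).

Lemma boundary_boundary k (c : chain P k.+2) : boundary (boundary c) = 0.
Proof.
pose F (s : simplex P k.+2) (p : 'I_k.+2 * 'I_k.+1) : chain P k :=
  (-1) ^+ (p.1 + p.2) *: << face (face s p.1) p.2 >>.
have bF s : boundary (boundary << s >>) = \sum_p F s p.
  rewrite {2}/boundary fgliftU1 raddf_sum /= -(pair_bigA _ (fun i j => F s (i, j))) /=.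
  apply: eq_bigr => i _; rewrite raddfZsign /= /boundary fgliftU1 scaler_sumr.
  by apply: eq_bigr => j _; rewrite scalerA -exprD.
apply: (@additive_freeg_eq0 _ _ (@boundary _ P k \o @boundary _ P k.+1)) => s /=.
rewrite bF (bigID (fun p : 'I_k.+2 * 'I_k.+1 => (p.2 < p.1)%N)) /=.
pose h (p : 'I_k.+2 * 'I_k.+1) : 'I_k.+2 * 'I_k.+1 := (inord p.2.+1, inord p.1).
pose h' (p : 'I_k.+2 * 'I_k.+1) : 'I_k.+2 * 'I_k.+1 := (inord p.2, inord p.1.-1).
rewrite (reindex_onto h h') => [|[i j] /= ji]; last first.
  by congr pair; apply: ord_inj; rewrite /= !inordK /=; have := ltn_ord i; have := ltn_ord j; lia.
apply/eqP; rewrite addr_eq0 -sumrN; apply/eqP.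
have hij (i : 'I_k.+2) (j : 'I_k.+1) : (i <= j)%N ->
    (inord i : 'I_k.+1) = i :> nat /\ (inord j.+1 : 'I_k.+2) = j.+1 :> nat.
  by move=> ij; rewrite !inordK //; have := ltn_ord j; lia.
have pE (p : 'I_k.+2 * 'I_k.+1) :
    ((h p).2 < (h p).1)%N && (h' (h p) == p) = ~~ (p.2 < p.1)%N.
  case: p => i j; rewrite /h /h' /=; have [ji|ij] := ltnP j i; last first.
    have [iE jE] := hij i j ij; rewrite iE jE ltnS ij /=.
    by apply/eqP; congr pair; apply: ord_inj; rewrite /= inordK.
  apply/negP => /andP[lt /eqP[]] /(congr1 (@nat_of_ord _)) iE _.
  have jE : (inord j.+1 : 'I_k.+2) = j.+1 :> nat by rewrite inordK //; have := ltn_ord j; lia.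
  move: lt iE; rewrite jE; set x : 'I_k.+1 := inord i => lt.
  have xk := ltn_ord x; have ? : (x < k.+2)%N by lia.
  by rewrite (inordK (m := x)) // => xi; lia.
apply: eq_big => [p|p]; first exact: pE.
rewrite pE; case: p => i j; rewrite -leqNgt /= => ij; have [iE jE] := hij i j ij.
rewrite /F /h /= iE jE -scaleNr; congr (_ *: << _ >>).
  by rewrite addSn exprS mulN1r addnC.
apply/val_inj/ffunP => l; rewrite !ffunE; congr (vertices s _).
by apply: ord_inj; rewrite /= iE jE /bump; lia.
Qed.
End BoundaryBoundary.

Section CrossPolytope.
Variable n : nat.

(* The index i : 'I_(2n) stands for the label i + 1 in {1, .., 2n}; then
   rev_ord is k |-> 2n + 1 - k, and the usual order of labels
   1, .., n, \bar n, .., \bar 1 is the order of column indices. *)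
Definition isotropic_index_set (I : {set 'I_n.*2}) : bool :=
  (I != set0) && [forall i in I, forall j in I, i != rev_ord j].

Record cross_face := CrossFace {
  face_set : {set 'I_n.*2};
  _ : isotropic_index_set face_set }.

HB.instance Definition _ := [isSub for face_set].
HB.instance Definition _ := [Choice of cross_face by <:].

Definition cross_face_le (I J : cross_face) := face_set I \subset face_set J.

Lemma cross_face_le_refl : reflexive cross_face_le.
Proof. by move=> I; apply: subxx. Qed.

Lemma cross_face_le_anti : antisymmetric cross_face_le.
Proof. by move=> I J IJ; apply/val_inj/eqP; rewrite eqEsubset. Qed.

Lemma cross_face_le_trans : transitive cross_face_le.
Proof. by move=> I J L; apply: subset_trans. Qed.

HB.instance Definition _ := Order.Le_isPOrder.Build (Order.Disp tt tt) cross_face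
  cross_face_le_refl cross_face_le_anti cross_face_le_trans.

(* A fundamental class of the (n-1)-sphere: the class of a cycle in which every
   top-dimensional simplex has coefficient 1 or -1; choosing such a class is
   choosing an orientation. *)
Definition is_fundamental_class (xi : reduced_homology cross_face n.-1) : Prop :=
  exists2 z : cycle cross_face n.-1, xi = homology_class z &
    forall s, coeff s (cycle_chain z) = 1 \/ coeff s (cycle_chain z) = -1.
End CrossPolytope.

Section SymplecticBuilding.
Variables (K : fieldType) (n : nat) (form : {biscalar 'cV[K]_n.*2}).

Definition isotropic_subspace (U : {vspace 'cV[K]_n.*2}) : Prop :=
  {in U &, forall u v, form u v = 0}.

Record building_vertex := BuildingVertex {
  vertex_space : {vspace 'cV[K]_n.*2};
  _ : (vertex_space != 0%VS) && `[< isotropic_subspace vertex_space >] }.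

HB.instance Definition _ := [isSub for vertex_space].
HB.instance Definition _ := [Choice of building_vertex by <:].

Definition building_le (U W : building_vertex) := (vertex_space U <= vertex_space W)%VS.

Lemma building_le_refl : reflexive building_le.
Proof. by move=> U; apply: subvv. Qed.

Lemma building_le_anti : antisymmetric building_le.
Proof. by move=> U W UW; apply/val_inj/eqP; rewrite eqEsubv. Qed.

Lemma building_le_trans : transitive building_le.
Proof. by move=> U W X; apply: subv_trans. Qed.

HB.instance Definition _ := Order.Le_isPOrder.Build (Order.Disp tt tt) building_vertex
  building_le_refl building_le_anti building_le_trans.

(* The family v_i is the family of columns of m. *)
Implicit Types m : 'M[K]_n.*2.

Definition col_span m (I : {set 'I_n.*2}) : {vspace 'cV[K]_n.*2} :=
  <<[seq col i m | i in I]>>%VS.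

Definition isotropy_condition m : Prop :=
  forall I, isotropic_index_set I -> isotropic_subspace (col_span m I).

Definition isotropic_frame m : Prop :=
  (forall i, col i m != 0) /\ isotropy_condition m.

Section FrameMap.
Variables (m : 'M[K]_n.*2) (hm : isotropic_frame m).

Lemma frame_map_subproof (I : cross_face n) :
  (col_span m (face_set I) != 0%VS) &&
  `[< isotropic_subspace (col_span m (face_set I)) >].
Proof.
case: hm => m_neq0 m_iso; case: I => I /= hI; apply/andP; split; last exact/asboolP/m_iso.
case/andP: hI => /set0Pn[i iI] _.
apply: contra (m_neq0 i) => /eqP U0; rewrite -memv0 -U0.
by apply/memv_span/mapP; exists i; rewrite ?mem_enum.
Qed.

Definition frame_map (I : cross_face n) : building_vertex :=
  BuildingVertex (frame_map_subproof I).

Lemma frame_map_homo : {homo frame_map : I J / (I <= J)%O}.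
Proof.
move=> I J /subsetP IJ; apply: sub_span => v /mapP[i]; rewrite mem_enum => /IJ iJ ->.
by apply/mapP; exists i; rewrite ?mem_enum.
Qed.
End FrameMap.

(* hstar is the isomorphism from the homology of the building to that of the
   Borel-Serre boundary. Only the zero-column case of the second branch is
   ever used: see isotropy_condition_exchange. *)
Definition modular_symbol (HX : zmodType)
    (hstar : reduced_homology building_vertex n.-1 -> HX)
    (xi : reduced_homology (cross_face n) n.-1) m : HX :=
  match pselect (isotropic_frame m) with
  | left hm => hstar (homology_map (frame_map_homo hm) xi)
  | right _ => 0
  end.

Definition orthogonal_indices m (x : 'cV[K]_n.*2) : {set 'I_n.*2} :=
  [set i | form x (col i m) == 0].

Definition exchange m (x : 'cV[K]_n.*2) (i : 'I_n.*2) : 'M[K]_n.*2 :=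
  let new_col j :=
    if j == i then col i m
    else if j == rev_ord i then x
    else form x (col i m) *: col j m - form x (col j m) *: col i m in
  \matrix_(r, j) new_col j r 0.

Lemma rev_ord_neq (i : 'I_n.*2) : i != rev_ord i.
Proof. by apply/eqP => /(congr1 (@nat_of_ord _)) /=; have := ltn_ord i; lia. Qed.

Lemma form_span0l (X : seq 'cV[K]_n.*2) v : {in X, forall w, form w v = 0} ->
  {in <<X>>%VS, forall u, form u v = 0}.
Proof.
move=> hX u; rewrite -[X]/(tval (in_tuple X)) => /coord_span ->.
by rewrite linear_sumlz big1 // => i _; rewrite linearZl_LR /= hX ?mulr0 // mem_nth.
Qed.

Lemma form_span0r (X : seq 'cV[K]_n.*2) v : {in X, forall w, form v w = 0} ->
  {in <<X>>%VS, forall u, form v u = 0}.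
Proof.
move=> hX u; rewrite -[X]/(tval (in_tuple X)) => /coord_span ->.
by rewrite linear_sumr big1 // => i _; rewrite linearZr_LR /= hX ?mulr0 // mem_nth.
Qed.

Lemma isotropy_conditionP m : (forall u, form u u = 0) ->
  isotropy_condition m <-> forall i j, i != rev_ord j -> form (col i m) (col j m) = 0.
Proof.
move=> alt; split=> [mi i j ij|h I /andP[_ /'forall_in_forall_inP hI] u v uU vU].
  apply: (mi [set i; j]).
  - apply/andP; split; first by apply/set0Pn; exists i; rewrite !inE eqxx.
    have ji : j != rev_ord i by apply: contra ij => /eqP->; rewrite rev_ordK.
    apply/'forall_in_forall_inP => a /set2P[]-> b /set2P[]->; rewrite ?rev_ord_neq //.
  - by apply/memv_span/mapP; exists i; rewrite ?mem_enum ?inE ?eqxx.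
  - by apply/memv_span/mapP; exists j; rewrite ?mem_enum ?inE ?eqxx ?orbT.
apply: form_span0l uU => _ /mapP[i iI ->]; apply: form_span0r vU => _ /mapP[j jI ->].
by apply: h; apply: hI; rewrite -mem_enum.
Qed.

Lemma isotropy_condition_exchange m x i : (forall u, form u u = 0) ->
  isotropy_condition m -> isotropy_condition (exchange m x i).
Proof.
move=> alt /(isotropy_conditionP _ alt) hm; apply/(isotropy_conditionP _ alt) => j k jk.
have altC u v : form u v = - form v u.
  have := alt (u + v); rewrite linearDr !linearDl !alt add0r addr0 addrC.
  by move/eqP; rewrite addr_eq0 => /eqP.
have colE l : col l (exchange m x i) =
    if l == i then col i m else if l == rev_ord i then x
    else form x (col i m) *: col l m - form x (col l m) *: col i m.
  by apply/matrixP => r c; rewrite !mxE; case: eqP => _; [|case: eqP => _]; rewrite ?(ord1 c) ?mxE.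
have x_new l : form x (form x (col i m) *: col l m - form x (col l m) *: col i m) = 0.
  by rewrite linearBr /= !linearZr_LR /= mulrC subrr.
have i_new l : l != rev_ord i ->
    form (col i m) (form x (col i m) *: col l m - form x (col l m) *: col i m) = 0.
  move=> li; rewrite linearBr /= !linearZr_LR /= alt mulr0 subr0 hm ?mulr0 //.
  by apply: contra li => /eqP->; rewrite rev_ordK.
rewrite !colE; case: (eqVneq j i) => [ji|ji]; case: (eqVneq k i) => [ki|ki].
- exact: alt.
- case: (eqVneq k (rev_ord i)) => [kj|kj]; last exact: i_new.
  by move: jk; rewrite ji kj rev_ordK eqxx.
- case: (eqVneq j (rev_ord i)) => [ji'|ji']; last by rewrite altC i_new ?oppr0.
  by move: jk; rewrite ji' ki eqxx.
case: (eqVneq j (rev_ord i)) => [jr|jr]; case: (eqVneq k (rev_ord i)) => [kr|kr].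
- exact: alt.
- exact: x_new.
- by rewrite altC x_new oppr0.
rewrite linearBr /= !linearZr_LR /=.
rewrite [form (_ - _) (col i m)]altC i_new // oppr0 mulr0 subr0.
rewrite linearBl /= !linearZl_LR /= [form (col j m) _]hm // [form (col i m) _]hm.
  by rewrite !mulr0 subrr mulr0.
by apply: contra kr => /eqP->; rewrite rev_ordK.
Qed.
End SymplecticBuilding.

(* Main.v *)
(* Replace the Borel-Serre boundary by the building. Sending U to U ∩ x^⊥, then to
   (U ∩ x^⊥) + <x>, then to <x>, contracts the poset of those isotropic U that meet x^⊥
   nontrivially. When no column of any m_i vanishes, the only faces I of the cross-polytope
   whose image under the frame m does not meet x^⊥ are the vertices {i} with <x, v_i> <> 0,
   so the sphere of m is homologous to the sum, over these i, of the star of {i} closed up by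
   the contraction of its boundary. The frames m and m_i agree on the star of {i}, and {i} is
   the only face whose image under m_i does not meet x^⊥: hence the i-th summand is [m_i].
   If a column x_ij vanishes, then v_i is orthogonal to all columns of m; each
   symbol involved then either has a zero column or is contracted onto a line. *)
From HB Require Import structures.
From mathcomp Require Import freeg.
Require Import Defs.
From mathcomp Require Import all_boot all_order all_algebra all_field.
From mathcomp Require Import sesquilinear boolp zify.

Set Implicit Arguments.
Unset Strict Implicit.
Unset Printing Implicit Defensive.

Import Order.TTheory GRing.Theory Num.Theory.
Local Open Scope ring_scope.

(** * Induction on integral chains *)

Section FreeInduction.
Variables (T : choiceType).

(** Generated as a subgroup rather than tested on coefficients, so that an identity between additive
    maps follows by induction from its case on simplices. *)
Inductive supported (A : T -> Prop) : {freeg T / int} -> Prop :=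
| supported0 : supported A 0
| supportedU s : A s -> supported A << s >>
| supportedB c1 c2 : supported A c1 -> supported A c2 -> supported A (c1 - c2).

Lemma supportedN A c : supported A c -> supported A (- c).
Proof. by rewrite -[- c]add0r; apply/supportedB/supported0. Qed.

Lemma supportedD A c1 c2 : supported A c1 -> supported A c2 -> supported A (c1 + c2).
Proof. by move=> h1 /supportedN h2; rewrite -[c2]opprK; apply: supportedB. Qed.

Lemma supported_sum A I (r : seq I) (Q : pred I) F :
  (forall i, Q i -> supported A (F i)) -> supported A (\sum_(i <- r | Q i) F i).
Proof. by move=> h; elim/big_rec: _ => [|i c /h]; [exact: supported0|exact: supportedD]. Qed.

Lemma supportedZ A (e : int) c : supported A c -> supported A (e *: c).
Proof.
move=> hc; rewrite -[e]intz scaler_int.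
have hn k : supported A (c *+ k).
  by rewrite -[k]card_ord -sumr_const; apply: supported_sum.
by case: e => k; [apply: hn|apply/supportedN/hn].
Qed.

Lemma supported_sub (A A' : T -> Prop) c :
  (forall s, A s -> A' s) -> supported A c -> supported A' c.
Proof.
move=> AA'; elim=> [|s /AA'|c1 c2 _ h1 _ h2]; first exact: supported0.
  exact: supportedU.
exact: supportedB.
Qed.

Lemma supported_all (A : T -> Prop) c : (forall s, A s) -> supported A c.
Proof.
move=> hA; rewrite -[c]freeg_sumE; apply: supported_sum => s _.
rewrite -[coeff s c]intz -freegU_mulz -scaler_int.
exact/supportedZ/supportedU.
Qed.

Lemma freeg_ind (S : {freeg T / int} -> Prop) :
  S 0 -> (forall c1 c2, S c1 -> S c2 -> S (c1 - c2)) -> (forall s, S << s >>) ->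
  forall c, S c.
Proof.
by move=> S0 SB SU c; elim: (@supported_all (fun=> True) c (fun=> I)) => // *; apply: SB.
Qed.
End FreeInduction.

(** * Subposets cut out by a predicate *)

Section SubPoset.
Context {d : Order.disp_t} (P : porderType d) (A : pred P).
Definition subposet := {u : P | A u}.
HB.instance Definition _ := [isSub of subposet for @sval P A].
HB.instance Definition _ := [Choice of subposet by <:].
HB.instance Definition _ := [SubChoice_isSubPOrder of subposet by <: with d].
End SubPoset.

(** * Cones over chains and their boundary *)

Section Cone.
Context {d : Order.disp_t} {P : porderType d} (p : P).

(** The apex [p] sits at index 0, which fixes the signs below: face 0 of a cone is its base. *)
Definition cone_vertices k (s : {ffun 'I_k -> P}) : {ffun 'I_k.+1 -> P} :=
  [ffun j => oapp s p (unlift ord0 j)].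

(* As for push_simplex, a degenerate cone is sent to 0. *)
Definition cone_simplex k (s : simplex P k) : chain P k.+1 :=
  if insub (cone_vertices (vertices s)) is Some t then << t >> else 0.

Definition cone k (c : chain P k) : chain P k.+1 := fglift (@cone_simplex k) c.

Lemma cone_is_additive k : zmod_morphism (@cone k).
Proof. exact: lift_is_additive. Qed.

HB.instance Definition _ k :=
  GRing.isZmodMorphism.Build (chain P k) (chain P k.+1) (@cone k) (@cone_is_additive k).

Lemma cone_vertices0 k (s : {ffun 'I_k -> P}) : cone_vertices s ord0 = p.
Proof. by rewrite ffunE unlift_none. Qed.

Lemma cone_verticesS k (s : {ffun 'I_k -> P}) j : cone_vertices s (lift ord0 j) = s j.
Proof. by rewrite ffunE liftK. Qed.

Lemma cone_simplexN k (s : simplex P k) j : vertices s j = p -> cone_simplex s = 0.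
Proof.
move=> sj; rewrite /cone_simplex; case: insubP => // t /strict_chainP/(_ ord0 (lift ord0 j)).
by rewrite cone_vertices0 cone_verticesS sj ltxx => /(_ isT).
Qed.

Lemma cone_strict k (s : simplex P k) :
  (forall j, p < vertices s j)%O -> strict_chain (cone_vertices (vertices s)).
Proof.
move=> ps; apply/strict_chainP => i j.
case: (unliftP ord0 j) => [j' ->|-> //]; case: (unliftP ord0 i) => [i' ->|->] ij.
  rewrite !cone_verticesS; move/strict_chainP: (valP s); apply.
  by move: ij; rewrite !lift0.
by rewrite cone_vertices0 cone_verticesS.
Qed.

Lemma lift_lift0 k (i : 'I_k.+1) (j : 'I_k) :
  lift (lift ord0 i) (lift ord0 j) = lift ord0 (lift i j).
Proof. by apply: val_inj; rewrite /= /bump; lia. Qed.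

Lemma cone_face_vertices k (s : {ffun 'I_k.+1 -> P}) i :
  cone_vertices (face_vertices s i) = face_vertices (cone_vertices s) (lift ord0 i).
Proof.
apply/ffunP => j; rewrite [RHS]ffunE; case: (unliftP ord0 j) => [j' ->|->].
  by rewrite lift_lift0 !cone_verticesS ffunE.
have -> : lift (lift ord0 i) ord0 = ord0 :> 'I_k.+2 by apply: val_inj.
by rewrite !cone_vertices0.
Qed.

(** If [p] is strictly below the first vertex, the cone is a genuine simplex: its face 0 is [s], and
    its other faces are the cones on the faces of [s], with opposite sign. If [p] is the first
    vertex, the cone on [s] degenerates, and among the cones on its faces only the one on face 0
    survives; it is [s] itself. *)
Lemma boundary_cone_simplex k (s : simplex P k.+1) : (forall j, p <= vertices s j)%O ->
  boundary (cone << s >>) + cone (boundary << s >>) = << s >>.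
Proof.
move=> ps; rewrite {2}/boundary {1}/cone !fgliftU1 raddf_sum /=.
under eq_bigr => i _ do rewrite raddfZsign /= /cone fgliftU1.
have [ps0|] := boolP (p < vertices s ord0)%O.
  have st : strict_chain (cone_vertices (vertices s)).
    apply: cone_strict => j; case: (unliftP ord0 j) => [j' ->|-> //].
    by apply: lt_trans ps0 _; move/strict_chainP: (valP s); apply.
  pose t : simplex P k.+2 := Simplex st.
  have -> : cone_simplex s = << t >> by rewrite /cone_simplex insubT.
  rewrite /boundary fgliftU1 big_ord_recl expr0 scale1r -addrA.
  rewrite -big_split big1 /= ?addr0 => [|i _].
    congr << _ >>; apply/val_inj/ffunP => j.
    by rewrite ffunE cone_verticesS.
  have -> : cone_simplex (face s i) = << face t (lift ord0 i) >>.
    by rewrite /cone_simplex cone_face_vertices (valK (face t (lift ord0 i))).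
  by rewrite /bump /= exprS mulN1r scaleNr addNr.
rewrite lt_neqAle ps andbT negbK => /eqP ps0.
rewrite (cone_simplexN (esym ps0)) raddf0 add0r big_ord_recl big1 ?addr0 => [|i _].
  rewrite expr0 scale1r /cone_simplex (_ : cone_vertices _ = vertices s) ?valK //.
  apply/ffunP => j; case: (unliftP ord0 j) => [j' ->|->]; last by rewrite cone_vertices0.
  by rewrite cone_verticesS ffunE.
case: k i s ps ps0 => [[]//|k] i s ps ps0.
rewrite (@cone_simplexN _ _ ord0) ?scaler0 // ffunE.
have -> : lift (lift ord0 i) ord0 = ord0 :> 'I_k.+2 by apply: val_inj.
exact: esym.
Qed.

Definition above k (s : simplex P k) : Prop := forall j, (p <= vertices s j)%O.

Lemma boundary_cone k (c : chain P k.+1) : supported (@above k.+1) c ->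
  boundary (cone c) + cone (boundary c) = c.
Proof.
elim=> [|s ps|c1 c2 _ h1 _ h2]; first by rewrite !raddf0 addr0.
  exact: boundary_cone_simplex.
by rewrite !raddfB /= addrACA -opprD h1 h2.
Qed.

(** The only generator in degree 0 is the empty simplex; its cone is the vertex [p], which the
    augmentation sends back to it. *)
Lemma boundary_cone0 (c : chain P 0) : boundary (cone c) = c.
Proof.
apply: (@additive_freeg_eq _ _ (@boundary _ P 0 \o @cone 0) idfun) => s /=.
rewrite /cone fgliftU1 /cone_simplex insubT => [|st].
  by apply: cone_strict => -[].
rewrite /boundary fgliftU1 big_ord_recl big_ord0 expr0 scale1r addr0.
by congr << _ >>; apply/val_inj/ffunP => -[].
Qed.

Lemma cone_above k (c : chain P k) :
  supported (@above k) c -> supported (@above k.+1) (cone c).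
Proof.
elim=> [|s ps|c1 c2 _ h1 _ h2]; first by rewrite raddf0; exact: supported0.
  rewrite /cone fgliftU1 /cone_simplex; case: insubP => [t _ tE|_]; last exact: supported0.
  apply: supportedU => j; rewrite tE.
  by case: (unliftP ord0 j) => [j' ->|->]; rewrite ?cone_verticesS ?cone_vertices0.
by rewrite raddfB; apply: supportedB.
Qed.
End Cone.

(** * Chain homotopies by the method of acyclic carriers *)

Section AcyclicCarrier.
Context {d d' : Order.disp_t} (P : porderType d) (Q : porderType d').
Variable q : P -> Q.
Hypothesis q_homo : {homo q : u v / (u <= v)%O}.
Variable F : forall k, {additive chain P k -> chain Q k}.
Hypothesis F_boundary : forall k c, boundary (F k.+1 c) = F k (boundary c).
Hypothesis F_above : forall k (s : simplex P k.+1),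
  supported (@above _ _ (q (vertices s ord0)) k.+1) (F k.+1 << s >>).
Variable D0 : {additive chain P 0 -> chain Q 1}.
Hypothesis D0_boundary : forall c, boundary (D0 c) = F 0 c.
Hypothesis D0_above : forall v s, supported (@above _ _ (q v) 1) (D0 << s >>).

(** The carrier of [s] is the set of elements above the image under [q] of its least vertex, a cone
    with that image as apex. The defect of the homotopy already built on the boundary of [s] is
    coned off inside this carrier. The empty simplex has no least vertex, hence the separate datum
    [D0]. *)
Fixpoint carrier_homotopy k : chain P k -> chain Q k.+1 :=
  match k with
  | 0 => D0
  | k'.+1 => fun c => fglift (fun s => cone (q (vertices s ord0))
               (F k'.+1 << s >> - carrier_homotopy (boundary << s >>))) c
  end.

Lemma carrier_homotopy_is_additive k : zmod_morphism (@carrier_homotopy k).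
Proof. by case: k => [|k]; [exact: raddfB|exact: lift_is_additive]. Qed.

HB.instance Definition _ k :=
  GRing.isZmodMorphism.Build (chain P k) (chain Q k.+1) (@carrier_homotopy k)
    (@carrier_homotopy_is_additive k).

Lemma vertex0_le k (s : simplex P k.+1) j : (vertices s ord0 <= vertices s j)%O.
Proof.
have [->//|j0] := eqVneq j ord0; apply: ltW.
by move/strict_chainP: (valP s); apply; rewrite lt0n.
Qed.

Lemma carrier_homotopyU k (s : simplex P k.+1) :
  carrier_homotopy << s >> = cone (q (vertices s ord0))
    (F k.+1 << s >> - carrier_homotopy (boundary << s >>)).
Proof. by rewrite /= fgliftU1. Qed.

Lemma above_trans (u v : Q) k (s : simplex Q k) : (u <= v)%O -> above v s -> above u s.
Proof. by move=> uv vs j; apply: le_trans uv (vs j). Qed.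

(** The faces of [s] have their vertices above the least vertex of [s], so by monotonicity of [q]
    their carriers lie in that of [s], and the defect stays there. *)
Lemma carrier_homotopy_above k (s : simplex P k) v : above v s ->
  supported (@above _ _ (q v) k.+1) (carrier_homotopy << s >>).
Proof.
elim: k s v => [|k IH] s v vs; first exact: D0_above.
apply: (@supported_sub _ (@above _ _ (q (vertices s ord0)) k.+2)) => [t|].
  by apply/above_trans/q_homo/vs.
rewrite carrier_homotopyU; apply: cone_above; apply: supportedB; first exact: F_above.
rewrite /boundary fgliftU1 raddf_sum; apply: supported_sum => i _.
rewrite raddfZsign /=; apply: supportedZ; apply: IH => j; rewrite ffunE.
exact: vertex0_le.
Qed.

(** The hypothesis comes from the preceding degree and makes the defect a cycle; the cone formula
    then exhibits the defect as the boundary of its cone. *)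
Lemma carrier_homotopy_simplex k (s : simplex P k.+1) :
  boundary (carrier_homotopy (boundary << s >>)) = F k (boundary << s >>) ->
  boundary (carrier_homotopy << s >>) + carrier_homotopy (boundary << s >>) = F k.+1 << s >>.
Proof.
move=> h; rewrite carrier_homotopyU; set c := F _ _ - _.
have /boundary_cone : supported (@above _ _ (q (vertices s ord0)) k.+1) c.
  apply: supportedB; first exact: F_above.
  rewrite /boundary fgliftU1 raddf_sum; apply: supported_sum => i _.
  rewrite raddfZsign /=; apply: supportedZ; apply: carrier_homotopy_above => j.
  by rewrite ffunE vertex0_le.
have -> : boundary c = 0 by rewrite raddfB /= h F_boundary subrr.
by rewrite raddf0 addr0 => ->; rewrite subrK.
Qed.

Lemma carrier_homotopyE k (c : chain P k.+1) :
  boundary (carrier_homotopy c) + carrier_homotopy (boundary c) = F k.+1 c.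
Proof.
elim: k c => [|k IH]; apply: freeg_ind => [|c1 c2 h1 h2|s].
1,4: by rewrite !raddf0 addr0.
1,3: by rewrite !raddfB addrACA -opprD /= h1 h2.
  by apply: carrier_homotopy_simplex; rewrite D0_boundary.
apply: carrier_homotopy_simplex; rewrite -IH boundary_boundary.
by rewrite (raddf0 (@carrier_homotopy k)) addr0.
Qed.
End AcyclicCarrier.

(** * Contractions from comparable maps of posets *)

Section Contraction.
Context {d d' : Order.disp_t} (P : porderType d) (Q : porderType d').

Lemma push_chain_above (f : P -> Q) y k (s : simplex P k) : (forall j, y <= f (vertices s j))%O ->
  supported (@above _ _ y k) (push_chain f << s >>).
Proof.
move=> h; rewrite /push_chain fgliftU1 /push_simplex.
case: insubP => [t _ tE|_]; last exact: supported0.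
by apply: supportedU => j; rewrite tE ffunE.
Qed.

Lemma push_chain0 (f g : P -> Q) (c : chain P 0) : push_chain f c = push_chain g c.
Proof.
apply: (@additive_freeg_eq _ _ (@push_chain _ _ _ _ f 0) (@push_chain _ _ _ _ g 0)) => s /=.
rewrite /push_chain !fgliftU1 /push_simplex.
by rewrite (_ : [ffun _ => _] = [ffun i => g (vertices s i)]) //; apply/ffunP=> -[].
Qed.

(** Both images of a simplex lie above the image under [f] of its least vertex, so [f] carries the
    difference of the two pushforwards. This difference vanishes on the empty simplex, so the
    homotopy starts from 0. *)
Lemma comparable_homotopy (f g : P -> Q) :
  {homo f : u v / (u <= v)%O} -> {homo g : u v / (u <= v)%O} -> (forall u, f u <= g u)%O ->
  exists D : forall k, {additive chain P k -> chain Q k.+1}, forall k (c : chain P k.+1),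
    boundary (D k.+1 c) + D k (boundary c) = push_chain g c - push_chain f c.
Proof.
move=> fh gh fg.
pose F k : {additive chain P k -> chain Q k} := @push_chain _ _ _ _ g k \- @push_chain _ _ _ _ f k.
exists (@carrier_homotopy _ _ _ _ f F \0); apply: carrier_homotopyE => //.
- by move=> k c; rewrite /= raddfB /= !push_boundary.
- move=> k s; apply: supportedB; apply: push_chain_above => i.
    exact: le_trans (fh _ _ (vertex0_le s i)) (fg _).
  exact/fh/vertex0_le.
- by move=> c; rewrite /= raddf0 (push_chain0 g f) subrr.
by move=> v s; apply: supported0.
Qed.

(** Quillen's conical contraction along [j >= a <= b >= p]: the first two comparisons give
    homotopies from [j] to [a] and from [a] to [b], and the pushforward by [b] is carried by the
    constant map [p]. *)
Lemma conical_contraction (j a b : P -> Q) (p : Q) :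
  {homo j : u v / (u <= v)%O} -> {homo a : u v / (u <= v)%O} -> {homo b : u v / (u <= v)%O} ->
  (forall u, a u <= j u)%O -> (forall u, a u <= b u)%O -> (forall u, p <= b u)%O ->
  exists D : forall k, {additive chain P k -> chain Q k.+1}, forall k (c : chain P k.+1),
    boundary (D k.+1 c) + D k (boundary c) = push_chain j c.
Proof.
move=> jh ah bh aj ab pb.
have [D1 h1] := comparable_homotopy ah jh aj.
have [D2 h2] := comparable_homotopy ah bh ab.
have [D3 h3] : exists D : forall k, {additive chain P k -> chain Q k.+1},
    forall k (c : chain P k.+1),
    boundary (D k.+1 c) + D k (boundary c) = push_chain b c.
  (* The empty simplex is filled by the vertex [p]. *)
  pose D0 : {additive chain P 0 -> chain Q 1} := @cone _ _ p 0 \o @push_chain _ _ _ _ b 0.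
  exists (@carrier_homotopy _ _ _ _ (fun=> p) (fun k => @push_chain _ _ _ _ b k) D0).
  apply: carrier_homotopyE => //.
  - by move=> k c; rewrite /= push_boundary.
  - by move=> k s; apply: push_chain_above => i.
  - by move=> c; apply: boundary_cone0.
  by move=> v s; apply: cone_above; apply: push_chain_above => -[].
exists (fun k => D1 k \- D2 k \+ D3 k) => k c /=.
have -> : push_chain j c =
    (push_chain j c - push_chain a c) - (push_chain b c - push_chain a c) + push_chain b c.
  by rewrite opprB addrA subrK subrK.
by rewrite -h1 -h2 -h3 raddfD raddfB opprD [X in _ = X + _]addrACA [RHS]addrACA.
Qed.
End Contraction.

(** * Restricting chains to a subposet *)

Section Restriction.
Context {d : Order.disp_t} (P : porderType d) (A : pred P).

(** A left inverse of the inclusion on chains, extended by 0 to simplices with a vertex outside [A].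
    It commutes with the boundary on simplices inside [A], though not in general. *)
Definition restrict_simplex k (s : simplex P k) : chain (subposet A) k :=
  if pselect (exists t : simplex (subposet A) k, forall i, val (vertices t i) = vertices s i)
    is left h then << projT1 (cid h) >> else 0.

Definition restrict k (c : chain P k) : chain (subposet A) k :=
  fglift (@restrict_simplex k) c.

Lemma restrict_is_additive k : zmod_morphism (@restrict k).
Proof. exact: lift_is_additive. Qed.

HB.instance Definition _ k :=
  GRing.isZmodMorphism.Build (chain P k) (chain (subposet A) k) (@restrict k)
    (@restrict_is_additive k).

Lemma restrictU k (s : simplex P k) (t : simplex (subposet A) k) :
  (forall i, val (vertices t i) = vertices s i) -> restrict << s >> = << t >>.
Proof.
move=> ts; rewrite /restrict fgliftU1 /restrict_simplex.
case: pselect => [h|[]]; last by exists t.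
congr << _ >>; apply/val_inj/ffunP => i; apply: val_inj.
by rewrite ts; case: cid => /= t' ->.
Qed.

Lemma subposet_simplex k (s : simplex P k) : (forall i, A (vertices s i)) ->
  exists t : simplex (subposet A) k, forall i, val (vertices t i) = vertices s i.
Proof.
move=> As; pose v := [ffun i => (exist _ (vertices s i) (As i) : subposet A)].
have vs : strict_chain v.
  apply/strict_chainP => i j ij; rewrite !ffunE.
  by move/strict_chainP: (valP s) => /(_ _ _ ij).
by exists (Simplex vs) => i; rewrite ffunE.
Qed.

(** Extending the contraction by 0 makes [H] and [h] additive on all chains of [P], so that [h] can
    later be applied to the boundary of each star separately. *)
Lemma subposet_contraction (a b : subposet A -> P) (p : P) k :
  {homo a : u v / (u <= v)%O} -> {homo b : u v / (u <= v)%O} ->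
  (forall u, a u <= val u)%O -> (forall u, a u <= b u)%O -> (forall u, p <= b u)%O ->
  exists (H : {additive chain P k.+1 -> chain P k.+2}) (h : {additive chain P k -> chain P k.+1}),
    forall s : simplex P k.+1, (forall i, A (vertices s i)) ->
      boundary (H << s >>) + h (boundary << s >>) = << s >>.
Proof.
move=> ah bh av ab pb.
have vh : {homo val : u v / (u <= v :> subposet A)%O >-> (u <= v)%O} by [].
have [D hD] := conical_contraction vh ah bh av ab pb.
exists (D k.+1 \o @restrict k.+1), (D k \o @restrict k) => s As /=.
have [t ts] := subposet_simplex As.
have -> : restrict (boundary << s >>) = boundary << t >>.
  rewrite /boundary !fgliftU1 raddf_sum; apply: eq_bigr => i _.
  rewrite raddfZsign /=; congr (_ *: _); apply: restrictU => j.
  by rewrite !ffunE.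
rewrite (restrictU ts) hD /push_chain fgliftU1 /push_simplex.
rewrite (_ : [ffun _ => _] = vertices s) ?valK //.
by apply/ffunP => i; rewrite ffunE.
Qed.
End Restriction.

(** * Cutting a cycle along the stars of incomparable vertices *)

Section Stars.
Context {d : Order.disp_t} (P : porderType d) (T : finType) (apex : T -> P).

Definition in_star t k (s : simplex P k) : bool := [exists j, vertices s j == apex t].

Definition star t k (c : chain P k) : chain P k :=
  fglift (fun s => if in_star t s then << s >> else 0) c.

Lemma star_is_additive t k : zmod_morphism (@star t k).
Proof. exact: lift_is_additive. Qed.

HB.instance Definition _ t k :=
  GRing.isZmodMorphism.Build (chain P k) (chain P k) (@star t k)
    (@star_is_additive t k).

Lemma starU t k (s : simplex P k) : star t << s >> = if in_star t s then << s >> else 0.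
Proof. by rewrite /star fgliftU1. Qed.

Lemma simplex_total k (s : simplex P k) i j :
  (vertices s i <= vertices s j)%O || (vertices s j <= vertices s i)%O.
Proof.
move/strict_chainP: (valP s) => st; case: (ltngtP i j) => [/st/ltW->//|/st/ltW->|/ord_inj->].
  by rewrite orbT.
by rewrite lexx.
Qed.

Hypothesis apex_incomparable : forall t t', (apex t <= apex t')%O -> t = t'.

(** The vertices of a simplex are pairwise comparable, distinct apexes are not. *)
Lemma star_disjoint t t' k (s : simplex P k) : in_star t s -> in_star t' s -> t = t'.
Proof.
move=> /existsP[i /eqP si] /existsP[j /eqP sj].
by have := simplex_total s i j; rewrite si sj => /orP[/apex_incomparable|/apex_incomparable].
Qed.

Context {d' : Order.disp_t} (Q : porderType d') (A : pred Q) (k : nat).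
Variables (H : {additive chain Q k.+1 -> chain Q k.+2}) (h : {additive chain Q k -> chain Q k.+1}).
Hypothesis Hh : forall s : simplex Q k.+1, (forall i, A (vertices s i)) ->
      boundary (H << s >>) + h (boundary << s >>) = << s >>.

(** What remains of [c] without the stars is pushed into [A] and contracted there by [H] and [h]. As
    [c] is a cycle, the boundary of this rest is minus the sum of the boundaries of the stars, so
    the [h] term distributes over the stars and closes each of them up. *)
Lemma star_decomposition (R : {set T}) (f : P -> Q) (f_homo : {homo f : u v / (u <= v)%O})
    (fA : forall u, (forall t, t \in R -> u <> apex t) -> A (f u)) (c : chain P k.+1) :
  boundary c = 0 -> exists e,
    push_chain f c = boundary e +
      \sum_(t in R) (push_chain f (star t c) - h (boundary (push_chain f (star t c)))).
Proof.
pose c' (c : chain P k.+1) := c - \sum_(t in R) star t c.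
(* For a single simplex: either it lies in exactly one star and cancels, or it lies in none and all
   its vertices go to [A], unless its image degenerates to 0. *)
have c'E x : push_chain f (c' x) =
    boundary (H (push_chain f (c' x))) + h (boundary (push_chain f (c' x))).
  elim/freeg_ind: x => [|x y hx hy|s].
  - have -> : c' 0 = 0 by rewrite /c' big1 ?subr0 // => t _; rewrite raddf0.
    by rewrite !raddf0 addr0.
  - have -> : c' (x - y) = c' x - c' y.
      rewrite /c' (eq_bigr (fun t => star t x - star t y)) => [|t _]; last by rewrite raddfB.
      by rewrite sumrB !opprD opprK addrACA.
    move: (c' x) (c' y) hx hy => u v hu hv.
    by rewrite !raddfB [RHS]addrACA -opprD /= -hu -hv.
  have [/existsP[t /andP[tR st]]|/existsPn ns] := boolP [exists t in R, in_star t s].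
    have -> : c' << s >> = 0.
      rewrite /c' (bigD1 t) //= starU st big1 ?addr0 ?subrr // => t' /andP[_ t't].
      by rewrite starU ifN //; apply: contra t't => st'; rewrite (star_disjoint st st').
    by rewrite !raddf0 addr0.
  have -> : c' << s >> = << s >>.
    rewrite /c' big1 ?subr0 // => t tR; rewrite starU ifN //.
    by have := ns t; rewrite tR.
  rewrite {1 2 3}/push_chain !fgliftU1 /push_simplex; case: insubP => [s' _ s'E|_].
    rewrite Hh // => i; rewrite s'E ffunE; apply: fA => t tR si.
    have := ns t; rewrite tR /= => /existsP[]; exists i; exact/eqP.
  by rewrite !raddf0 addr0.
move=> c0; exists (H (push_chain f (c' c))).
rewrite -[c in LHS](subrK (\sum_(t in R) star t c)) -/(c' c) raddfD /= [X in X + _]c'E.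
have -> : boundary (push_chain f (c' c)) =
    - \sum_(t in R) boundary (push_chain f (star t c)).
  have bc' : boundary (c' c) = - \sum_(t in R) boundary (star t c).
    by rewrite /c' raddfB /= c0 sub0r raddf_sum.
  rewrite -(push_boundary f_homo) bc' raddfN raddf_sum; congr (- _).
  by apply: eq_bigr => t _; rewrite -push_boundary.
by rewrite sumrB -addrA raddfN [X in _ + X = _]addrC !raddf_sum.
Qed.
End Stars.

(** * Homologous chains *)

Section Homologous.
Context {d : Order.disp_t} (P : porderType d).

(** A relation on all chains, so that it applies directly to the closed-up stars. *)
Definition homologous k (c1 c2 : chain P k) : Prop := exists e, c1 = boundary e + c2.

Lemma homologous_sym k (c1 c2 : chain P k) : homologous c1 c2 -> homologous c2 c1.
Proof. by case=> e ->; exists (- e); rewrite raddfN addKr. Qed.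

Lemma homologous_trans k (c2 c1 c3 : chain P k) :
  homologous c1 c2 -> homologous c2 c3 -> homologous c1 c3.
Proof. by case=> e -> [e' ->]; exists (e + e'); rewrite raddfD addrA. Qed.

Lemma homologous_sum k I (r : seq I) (R : pred I) (F G : I -> chain P k) :
  (forall i, R i -> homologous (F i) (G i)) ->
  homologous (\sum_(i <- r | R i) F i) (\sum_(i <- r | R i) G i).
Proof.
move=> h; elim/big_rec2: _ => [|i c1 c2 /h[e ->] [e' ->]].
  by exists 0; rewrite raddf0 addr0.
by exists (e + e'); rewrite raddfD addrACA.
Qed.

Lemma homology_class_sum k I (r : seq I) (R : pred I)
    (z : Defs.cycle P k) (F : I -> Defs.cycle P k) :
  homologous (cycle_chain z) (\sum_(i <- r | R i) cycle_chain (F i)) ->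
  homology_class z = \sum_(i <- r | R i) homology_class (F i).
Proof.
move=> [e ze].
have -> : \sum_(i <- r | R i) homology_class (F i) = homology_class (\sum_(i <- r | R i) F i).
  elim/big_rec2: _ => [|i c1 c2 _ ->]; rewrite /homology_class; first by rewrite raddf0.
  by rewrite raddfD.
apply/homology_class_eq; rewrite inE; apply/asboolP; exists e.
have -> : cycle_chain (z - \sum_(i <- r | R i) F i) =
    cycle_chain z - \sum_(i <- r | R i) cycle_chain (F i).
  by rewrite -![cycle_chain _]/(val _) raddfB raddf_sum.
by rewrite ze addrK.
Qed.
End Homologous.

(** * Contracting the isotropic subspaces that meet [x^⊥] *)

Section Perp.
Variables (K : fieldType) (n : nat) (form : {biscalar 'cV[K]_n.*2}).
Hypothesis alt : forall u, form u u = 0.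

Lemma alternating_sym u v : form u v = 0 -> form v u = 0.
Proof.
have := alt (u + v); rewrite linearDr !linearDl !alt add0r addr0 => /eqP.
by rewrite addr_eq0 => /eqP -> -> ; rewrite oppr0.
Qed.

Definition perp x : {vspace 'cV[K]_n.*2} := lker (linfun (form x : 'cV[K]_n.*2 -> K^o)).

Lemma mem_perp x u : (u \in perp x) = (form x u == 0).
Proof. by rewrite memv_ker lfunE. Qed.

Variable x : 'cV[K]_n.*2.
Hypothesis x_neq0 : x != 0.

Definition meets_perp (U : building_vertex form) : bool :=
  (vertex_space U :&: perp x != 0)%VS.

Lemma meets_perpP (U : building_vertex form) u :
  u \in vertex_space U -> u != 0 -> form x u = 0 -> meets_perp U.
Proof.
move=> uU u0 xu; apply: contra u0 => /eqP U0.
by rewrite -memv0 -U0 memv_cap uU mem_perp xu eqxx.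
Qed.

Lemma vertex_isotropic (U : building_vertex form) : isotropic_subspace form (vertex_space U).
Proof. by case: U => U /= /andP[_ /asboolP]. Qed.

Fact line_subproof : (<[x]>%VS != 0%VS) && `[< isotropic_subspace form <[x]>%VS >].
Proof.
apply/andP; split; first by rewrite -dimv_eq0 dim_vline x_neq0.
apply/asboolP => _ _ /vlineP[a ->] /vlineP[b ->].
by rewrite linearZl_LR linearZr_LR /= alt !mulr0.
Qed.

Definition line_vertex : building_vertex form := BuildingVertex line_subproof.

Fact trace_subproof (U : subposet meets_perp) :
  (vertex_space (val U) :&: perp x != 0)%VS &&
  `[< isotropic_subspace form (vertex_space (val U) :&: perp x)%VS >].
Proof.
apply/andP; split; first exact: (valP U).
apply/asboolP => u v /memv_capP[uU _] /memv_capP[vU _].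
exact: (vertex_isotropic uU vU).
Qed.

Definition trace_vertex U : building_vertex form := BuildingVertex (trace_subproof U).

(** Passing to [U ∩ x^⊥] first keeps the sum with [<x>] isotropic, since [x] is orthogonal to that
    trace and to itself; [U + <x>] need not be isotropic. *)
Fact join_subproof (U : subposet meets_perp) :
  (vertex_space (val U) :&: perp x + <[x]> != 0)%VS &&
  `[< isotropic_subspace form (vertex_space (val U) :&: perp x + <[x]>)%VS >].
Proof.
apply/andP; split.
  apply: contra x_neq0 => /eqP U0; rewrite -memv0 -U0.
  by apply: (subvP (addvSr _ _)); apply: memv_line.
apply/asboolP => u' v' /memv_addP[u uUx [_ /vlineP[a ->] ->]].
move=> /memv_addP[v vUx [_ /vlineP[b ->] ->]].
move: uUx vUx; rewrite !memv_cap !mem_perp => /andP[uU /eqP xu] /andP[vU /eqP xv].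
rewrite linearDl !linearDr /= !linearZl_LR !linearZr_LR /= alt xv (alternating_sym xu).
by rewrite (vertex_isotropic uU vU) !mulr0 !addr0.
Qed.

Definition join_vertex U : building_vertex form := BuildingVertex (join_subproof U).

(** The conical contraction is [U >= U ∩ x^⊥ <= U ∩ x^⊥ + <x> >= <x>]. *)
Lemma building_contraction k :
  exists (H : {additive chain (building_vertex form) k.+1 -> chain (building_vertex form) k.+2})
         (h : {additive chain (building_vertex form) k -> chain (building_vertex form) k.+1}),
    forall s : simplex (building_vertex form) k.+1, (forall i, meets_perp (vertices s i)) ->
      boundary (H << s >>) + h (boundary << s >>) = << s >>.
Proof.
apply: (@subposet_contraction _ _ _ trace_vertex join_vertex line_vertex).
- by move=> U W UW; apply: capvS.
- by move=> U W UW; apply/addvS/subvv/capvS.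
- by move=> U; apply: capvSl.
- by move=> U; apply: addvSl.
- by move=> U; apply: addvSr.
Qed.
End Perp.

(** * Cycles representing modular symbols *)

Section SymbolCycle.
Variables (K : fieldType) (n : nat) (form : {biscalar 'cV[K]_n.*2}).
Hypothesis alt : forall u, form u u = 0.
Implicit Types (m : 'M[K]_n.*2) (x w : 'cV[K]_n.*2) (z : Defs.cycle (cross_face n) n.-1).

Definition symbol_cycle z m : Defs.cycle (building_vertex form) n.-1 :=
  if pselect (isotropic_frame form m) is left hm then push_cycle (frame_map_homo hm) z else 0.

Lemma modular_symbol_class (HX : zmodType)
    (hstar : {additive reduced_homology (building_vertex form) n.-1 -> HX}) z m :
  modular_symbol hstar (homology_class z) m = hstar (homology_class (symbol_cycle z m)).
Proof.
rewrite /modular_symbol /symbol_cycle; case: pselect => [hm|_].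
  by rewrite homology_map_class.
by rewrite /homology_class !raddf0.
Qed.

Lemma symbol_cycle_frame z m (hm : isotropic_frame form m) :
  cycle_chain (symbol_cycle z m) = push_chain (frame_map hm) (cycle_chain z).
Proof. by rewrite /symbol_cycle; case: pselect => // hm'; rewrite (Prop_irrelevance hm' hm). Qed.

Lemma symbol_cycle_notframe z m : ~ isotropic_frame form m ->
  cycle_chain (symbol_cycle z m) = 0.
Proof. by rewrite /symbol_cycle; case: pselect. Qed.

Lemma cycle_boundary {d : Order.disp_t} (P : porderType d) k (z : Defs.cycle P k) :
  boundary (cycle_chain z) = 0.
Proof. exact/eqP/(valP z). Qed.

Lemma col_in_span m (I : {set 'I_n.*2}) j : j \in I -> col j m \in col_span m I.
Proof. by move=> jI; apply/memv_span/mapP; exists j; rewrite ?mem_enum. Qed.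

Lemma cross_face_neq0 (I : cross_face n) : exists i, i \in face_set I.
Proof. by case: I => I /= /andP[/set0Pn]. Qed.

Lemma cross_face_isotropic (I : cross_face n) i j :
  i \in face_set I -> j \in face_set I -> j != rev_ord i.
Proof. by case: I => I /= /andP[_ /'forall_in_forall_inP hI] iI jI; apply: hI. Qed.

Fact apex_subproof (i : 'I_n.*2) : isotropic_index_set [set i].
Proof.
apply/andP; split; first by apply/set0Pn; exists i; rewrite inE.
by apply/'forall_in_forall_inP => _ /set1P-> _ /set1P->; apply: rev_ord_neq.
Qed.

(** The singletons are the vertices of the cross-polytope before subdivision; the cycle is cut along
    their stars. *)
Definition apex i : cross_face n := CrossFace (apex_subproof i).

Lemma apex_incomparable i j : (apex i <= apex j)%O -> i = j.
Proof. by rewrite /Order.le /= /cross_face_le /= sub1set inE => /eqP. Qed.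

Lemma neq_apex (I : cross_face n) i : i \in face_set I -> I <> apex i ->
  exists2 j, j \in face_set I & j != i.
Proof.
move=> iI nI; apply/exists_inP; apply: contra_notT nI => /exists_inPn h.
apply/val_inj/setP => j /=; rewrite inE; apply/idP/eqP => [/h|->//].
by rewrite negbK => /eqP.
Qed.

(** Every face goes to a span containing a nonzero column orthogonal to [w], so the whole sphere
    lies in the poset contracted by means of [w]; no star has to be removed. *)
Lemma symbol_cycle_cone z m w : w != 0 -> (forall j, form w (col j m) = 0) ->
  homologous (cycle_chain (symbol_cycle z m)) 0.
Proof.
move=> w0 wm; have [hm|nhm] := pselect (isotropic_frame form m); last first.
  by rewrite symbol_cycle_notframe //; exists 0; rewrite raddf0 addr0.
rewrite (symbol_cycle_frame z hm); have [H [h Hh]] := building_contraction alt w0 n.-1.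
have [|e ->] := star_decomposition apex_incomparable Hh (R := set0)
  (frame_map_homo hm) _ (cycle_boundary z); last first.
  by exists e; rewrite big_set0.
move=> I _; have [j jI] := cross_face_neq0 I.
apply: (@meets_perpP _ _ _ _ _ (col j m)) => //; last by case: hm.
exact: col_in_span.
Qed.

(** * Exchanged frames and the degenerate case *)

Section Exchange.
Variables (m : 'M[K]_n.*2) (x : 'cV[K]_n.*2).
Hypotheses (hm : isotropic_frame form m) (x_neq0 : x != 0).

Definition exchange_col i j :=
  form x (col i m) *: col j m - form x (col j m) *: col i m.

Lemma col_exchange i j : col j (exchange form m x i) =
  if j == i then col i m else if j == rev_ord i then x else exchange_col i j.
Proof.
by apply/matrixP => r c; rewrite !mxE; case: eqP => _; [|case: eqP => _]; rewrite ?(ord1 c) ?mxE.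
Qed.

Lemma form_exchange_col i j : form x (exchange_col i j) = 0.
Proof. by rewrite linearBr /= !linearZr_LR /= mulrC subrr. Qed.

Lemma frame_isotropy i j : i != rev_ord j -> form (col i m) (col j m) = 0.
Proof. by case: hm => _ /(isotropy_conditionP _ alt); apply. Qed.

(** An isotropic set containing [i] avoids [rev_ord i], so the column [x] does not enter. The others
    undergo a triangular substitution, invertible because [<x, v_i>] is nonzero. *)
Lemma col_span_exchange i I : isotropic_index_set I -> i \in I -> form x (col i m) != 0 ->
  col_span (exchange form m x i) I = col_span m I.
Proof.
move=> /andP[_ /'forall_in_forall_inP hI] iI xi.
apply/eqP; rewrite eqEsubv; apply/andP; split; apply/span_subvP => _ /mapP[j + ->].
all: rewrite mem_enum => jI.
  rewrite col_exchange (negPf (hI j jI i iI)); case: eqP => _; first exact: col_in_span.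
  by apply/memvB; apply/memvZ/col_in_span.
have iE : col i m \in col_span (exchange form m x i) I.
  by have := col_in_span (exchange form m x i) iI; rewrite col_exchange eqxx.
have [->//|ji] := eqVneq j i.
have := col_in_span (exchange form m x i) jI.
rewrite col_exchange (negPf ji) (negPf (hI j jI i iI)) => jE.
have -> : col j m = (form x (col i m))^-1 *: (exchange_col i j + form x (col j m) *: col i m).
  by rewrite subrK scalerA mulVf // scale1r.
by apply/memvZ/memvD => //; apply/memvZ.
Qed.

(* If some exchange column vanishes then two columns of m, not indexed by opposite labels, are
   proportional; such a column is orthogonal to all the others. *)
Lemma degenerate_exchange z a b : form x (col a m) != 0 -> b != a -> b != rev_ord a ->
  exchange_col a b = 0 ->
  homologous (cycle_chain (symbol_cycle z m)) 0 /\
  forall i, form x (col i m) != 0 ->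
    homologous (cycle_chain (symbol_cycle z (exchange form m x i))) 0.
Proof.
move=> xa ba bra ab0; have [m0 _] := hm.
have abE : form x (col a m) *: col b m = form x (col b m) *: col a m 
  by apply/eqP; rewrite -subr_eq0; apply/eqP.
have xb : form x (col b m) != 0.
  apply: contraNneq (m0 b) => xb0; move/eqP: abE.
  by rewrite xb0 scale0r scaler_eq0 (negPf xa).
(* Only [l = rev_ord a] is in question; there [v_a] is a multiple of [v_b], and [b] is not opposite
   to [l] because [b] differs from [a]. *)
have a_perp l : form (col a m) (col l m) = 0.
  have [al|] := eqVneq a (rev_ord l); last exact: frame_isotropy.
  apply/(mulfI xb); rewrite mulr0 -linearZl_LR /= -abE linearZl_LR /= frame_isotropy ?mulr0 //.
  by rewrite -al.
split=> [|i xi]; first exact: symbol_cycle_cone (m0 a) a_perp.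
have [f0|nf] := pselect (isotropic_frame form (exchange form m x i)); last first.
  by rewrite symbol_cycle_notframe //; exists 0; rewrite raddf0 addr0.
have w_new l : l != i -> l != rev_ord i -> exchange_col i l != 0.
  by move=> li lri; case: f0 => /(_ l); rewrite col_exchange (negPf li) (negPf lri).
(* This vector will be orthogonal to all columns of [m_i]. If [b] is neither [i] nor [rev_ord i], it
   is proportional to column [b] of [m_i], which is nonzero; otherwise [a] is neither of them, and
   the vector is itself a column of [m_i]. *)
have w0 : exchange_col i a != 0.
  have [bi|bi] := boolP ((b != i) && (b != rev_ord i)).
    have /andP[bi1 bi2] := bi; apply: contra (w_new b bi1 bi2) => /eqP w0.
    have : form x (col a m) *: exchange_col i b = form x (col b m) *: exchange_col i a.
      rewrite /exchange_col !scalerBr; congr (_ - _); last by rewrite !scalerA mulrC.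
      by rewrite scalerA mulrC -scalerA abE scalerA mulrC -scalerA.
    by move/eqP; rewrite w0 scaler0 scaler_eq0 (negPf xa).
  apply: w_new.
    by move: bi; apply: contraNneq => <-; rewrite ba bra.
  move: bi; apply: contraNneq => ai; move: ba bra; rewrite ai rev_ordK => -> ->.
  by [].
apply: (symbol_cycle_cone _ w0) => l; rewrite col_exchange.
have w_i j : j != rev_ord i -> form (exchange_col i a) (col j m) = 0.
  move=> ji; rewrite linearBl /= !linearZl_LR /= a_perp frame_isotropy ?mulr0 ?subr0 //.
  by apply: contra ji => /eqP->; rewrite rev_ordK.
have [_|li] := eqVneq l i; first exact/w_i/rev_ord_neq.
have [_|lri] := eqVneq l (rev_ord i); first exact/(alternating_sym alt)/form_exchange_col.
by rewrite /(exchange_col i l) linearBr /= !linearZr_LR /= !w_i ?rev_ord_neq // !mulr0 subrr.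
Qed.

(** * The nondegenerate case: matching stars *)

Section NonDegenerate.
Hypothesis exchange_col_neq0 : forall i j, form x (col i m) != 0 -> j != i ->
  j != rev_ord i -> exchange_col i j != 0.

Lemma exchange_frame i : form x (col i m) != 0 -> isotropic_frame form (exchange form m x i).
Proof.
have [m0 mi] := hm; move=> xi; split; last exact: isotropy_condition_exchange.
move=> j; rewrite col_exchange; have [_|ji] := eqVneq j i; first exact: m0.
by have [_|jri] := eqVneq j (rev_ord i); rewrite ?exchange_col_neq0.
Qed.

(** A column of [I] orthogonal to [x] lies in the intersection. If there is none, [I] is not a
    singleton, and two of its indices [i], [j] give the nonzero vector [exchange_col i j] of the
    span, orthogonal to [x]. *)
Lemma frame_meets_perp (I : cross_face n) :
  (forall t, t \in ~: orthogonal_indices form m x -> I <> apex t) ->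
  meets_perp x (frame_map hm I).
Proof.
have [m0 _] := hm; move=> nI.
have [/exists_inP[j jI /eqP xj]|/exists_inPn h] :=
  boolP [exists j in face_set I, form x (col j m) == 0].
  exact: (@meets_perpP _ _ _ _ (frame_map hm I) _ (col_in_span m jI) (m0 j) xj).
have [i iI] := cross_face_neq0 I; have xi := h i iI.
have [|j jI ji] := neq_apex iI (nI i _); first by rewrite !inE.
have jri := cross_face_isotropic iI jI.
apply: (@meets_perpP _ _ _ _ (frame_map hm I) (exchange_col i j)) => /=; last 2 first.
- exact: exchange_col_neq0.
- exact: form_exchange_col.
by apply/memvB; apply/memvZ/col_in_span.
Qed.

(** All columns of [m_i] except the [i]-th are orthogonal to [x], and a face other than [{i}] has an
    index different from [i]. *)
Lemma exchange_meets_perp i (hmi : isotropic_frame form (exchange form m x i)) (I : cross_face n) :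
  (forall t, t \in [set i] -> I <> apex t) -> meets_perp x (frame_map hmi I).
Proof.
have [m0 _] := hmi; move=> nI.
have [j jI ji] : exists2 j, j \in face_set I & j != i.
  have [iI|iI] := boolP (i \in face_set I); first by apply: neq_apex iI (nI i _); rewrite inE.
  by have [j jI] := cross_face_neq0 I; exists j => //; apply: contraNneq iI => <-.
apply: (@meets_perpP _ _ _ _ (frame_map hmi I) _ (col_in_span _ jI) (m0 j)).
rewrite col_exchange (negPf ji).
by case: eqP => _; [exact: alt|exact: form_exchange_col].
Qed.

(** In a simplex through [{i}] every vertex is a nonempty face comparable with [{i}], hence contains
    [i]; on such faces both frames have the same span. *)
Lemma push_star_exchange i (hmi : isotropic_frame form (exchange form m x i)) k
    (c : chain (cross_face n) k) : form x (col i m) != 0 ->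
  push_chain (frame_map hmi) (star apex i c) = push_chain (frame_map hm) (star apex i c).
Proof.
move=> xi; elim/freeg_ind: c => [|c1 c2 h1 h2|s]; first by rewrite !raddf0.
  by rewrite !raddfB /= h1 h2.
rewrite starU; case: ifP => [/existsP[j /eqP sj]|_]; last by rewrite !raddf0.
rewrite /push_chain !fgliftU1 /push_simplex; set v := [ffun _ => _]; set v' := [ffun _ => _].
suff -> : v = v' by [].
apply/ffunP => l; rewrite !ffunE; apply: val_inj; apply: col_span_exchange => //.
  exact: (valP (vertices s l)).
have := simplex_total s l j; rewrite sj /Order.le /= /cross_face_le /= => /orP[|].
  2: by rewrite sub1set.
have [i' i'I] := cross_face_neq0 (vertices s l).
by move/subsetP/(_ _ i'I); rewrite inE => /eqP <-.
Qed.

(** The star decomposition is applied with the same [H] and [h] to [m], removing the stars of all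
    [i] with [<x, v_i>] nonzero, and to each [m_i], removing only that of [{i}]. The closed-up star
    [G i] occurs in both. *)
Lemma nondegenerate_exchange z :
  homologous (cycle_chain (symbol_cycle z m))
    (\sum_(i in ~: orthogonal_indices form m x) cycle_chain (symbol_cycle z (exchange form m x i))).
Proof.
have [H [h Hh]] := building_contraction alt x_neq0 n.-1.
pose p c := c - h (boundary c).
pose G i := p (push_chain (frame_map hm) (star apex i (cycle_chain z))).
apply: (homologous_trans (c2 := \sum_(i in ~: orthogonal_indices form m x) G i)).
  rewrite (symbol_cycle_frame z hm).
  have [e ->] := star_decomposition apex_incomparable Hh
    (frame_map_homo hm) frame_meets_perp (cycle_boundary z).
  by exists e.
apply: homologous_sum => i; rewrite !inE => xi; apply: homologous_sym.
have hmi := exchange_frame xi; rewrite (symbol_cycle_frame z hmi).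
have [e ->] := star_decomposition apex_incomparable Hh
  (frame_map_homo hmi) (exchange_meets_perp hmi) (cycle_boundary z).
by exists e; rewrite big_set1 push_star_exchange.
Qed.
End NonDegenerate.

Lemma homologous_exchange z :
  homologous (cycle_chain (symbol_cycle z m))
    (\sum_(i in ~: orthogonal_indices form m x) cycle_chain (symbol_cycle z (exchange form m x i))).
Proof.
have [nd|/existsNP[a /existsNP[b]]] := pselect (forall i j, form x (col i m) != 0 -> j != i ->
  j != rev_ord i -> exchange_col i j != 0); first exact: nondegenerate_exchange.
move=> /not_implyP[xa /not_implyP[ba /not_implyP[bra /negP]]]; rewrite negbK => /eqP ab0.
have [h1 h2] := degenerate_exchange z xa ba bra ab0.
(* In the degenerate case both sides are boundaries. *)
apply: homologous_trans h1 (homologous_sym _).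
have h i : i \in ~: orthogonal_indices form m x ->
    homologous (cycle_chain (symbol_cycle z (exchange form m x i))) 0.
  by rewrite !inE => /h2.
by have := homologous_sum (index_enum _) h; rewrite big1_eq.
Qed.
End Exchange.

End SymbolCycle.

(** * From homologous cycles to the identity of symbols *)

Theorem theorem3p16 (K : fieldExtType rat) (n : nat) (hn : (0 < n)%N)
    (form : {biscalar 'cV[K]_n.*2})
    (form_alternating : forall u, form u u = 0)
    (form_nondegenerate : forall u, (forall v, form u v = 0) -> u = 0)
    (xi : reduced_homology (cross_face n) n.-1)
    (xi_fundamental : is_fundamental_class xi)
    (HX : zmodType)
    (hstar : {additive reduced_homology (building_vertex form) n.-1 -> HX})
    (hstar_bij : bijective hstar)
    (m : 'M[K]_n.*2)
    (m_neq0 : forall i, col i m != 0)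
    (m_isotropy : isotropy_condition form m)
    (x : 'cV[K]_n.*2) (x_neq0 : x != 0) :
  modular_symbol hstar xi m =
  \sum_(i in ~: orthogonal_indices form m x)
     modular_symbol hstar xi (exchange form m x i).
Proof.
have [z -> _] := xi_fundamental.
rewrite modular_symbol_class.
have hm : isotropic_frame form m by [].
rewrite (homology_class_sum (homologous_exchange form_alternating hm x_neq0 z)).
by rewrite raddf_sum; apply: eq_bigr => i _; rewrite modular_symbol_class.
Qed.
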